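(* Let $\mathcal{H}=\{\mathcal{M}_{Y_1},\ldots,\mathcal{M}_{Y_n}\}$ be an associative family of matroids whose graph $\mathcal{G}_{\mathcal{H}}$ is connected and has non-empty edge set. Let $\mathcal{H}$ be partitioned as $\mathcal{H}_1\uplus\mathcal{H}_2$. Then $\mathcal{H}$ is rigid iff $\mathcal{H}_1$, $\mathcal{H}_2$ and $\{\leftrightarrow(\mathcal{H}_1),\leftrightarrow(\mathcal{H}_2)\}$ are rigid.
   Context: All matroids are on finite sets; $r$ is rank, $\mathcal{M}^*$ the dual, $\mathcal{M}\circ T$ restriction to $T$, $\mathcal{M}\times T=(\mathcal{M}^*\circ T)^*$ contraction to $T$. The union $\mathcal{M}_{Y_1}\vee\cdots\vee\mathcal{M}_{Y_m}$ of matroids on (not necessarily equal) sets $Y_i$ is the matroid on $\bigcup_iY_i$ whose independent sets are the unions $I_1\cup\cdots\cup I_m$ with $I_i$ independent in $\mathcal{M}_{Y_i}$. An associative family is a finite family $\{\mathcal{M}_{Y_1},\ldots,\mathcal{M}_{Y_m}\}$ of matroids, $\mathcal{M}_{Y_i}$ on $Y_i$, such that no element of $\bigcup_iY_i$ belongs to more than two of the $Y_i$. Let $Z$ be the set of elements belonging to exactly one of the $Y_i$; define $\leftrightarrow(\mathcal{H})=(\mathcal{M}_{Y_1}\vee\cdots\vee\mathcal{M}_{Y_m})\times Z$ (if $Z=\emptyset$ this is the matroid $\mathcal{M}_\emptyset$ on the empty set). The graph $\mathcal{G}_{\mathcal{H}}$ has the members $\mathcal{M}_{Y_i}$ as vertices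 and the elements of $\bigcup_iY_i$ as edges: $e$ joins $\mathcal{M}_{Y_i}$ and $\mathcal{M}_{Y_j}$ ($i\neq j$) if $e\in Y_i\cap Y_j$, and $e$ is a self-loop at $\mathcal{M}_{Y_i}$ if $Y_i$ is the only set containing $e$. An associative family $\{\mathcal{M}_{Y_1},\ldots,\mathcal{M}_{Y_m}\}$ is rigid iff $r(\bigvee_i\mathcal{M}_{Y_i})=\sum_ir(\mathcal{M}_{Y_i})$ and $r(\bigvee_i\mathcal{M}_{Y_i}^* )=\sum_ir(\mathcal{M}_{Y_i}^* )$. A subfamily of an associative family is again an associative family, with $\leftrightarrow$ computed within the subfamily. The blocks of a partition are nonempty. *)

(* Defs.v *)
From mathcomp Require Import all_boot.

Set Implicit Arguments.
Unset Strict Implicit.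
Unset Printing Implicit Defensive.

(* The ambient finite type T only names elements; the set on which a matroid
   lives is the field [ground], so that matroids on different, possibly
   overlapping, sets have the same type. *)
Record matroid (T : finType) := Matroid {
  ground : {set T};
  indep : {set {set T}};
  indep_ground : forall I : {set T}, I \in indep -> I \subset ground;
  indep0 : set0 \in indep;
  indepS : forall I J : {set T}, I \subset J -> J \in indep -> I \in indep;
  indep_aug : forall I J : {set T}, I \in indep -> J \in indep -> #|I| < #|J| ->
    exists2 x, x \in J :\: I & x |: I \in indep
}.

Section MatroidOperations.

Variables (T : finType).
Implicit Types (M : matroid T) (A B I J X : {set T}).

Definition rank M : nat := \max_(I in indep M) #|I|.

Definition bases M : {set {set T}} :=
  [set B | maxset (fun I => I \in indep M) B].

Lemma base_indep M B : B \in bases M -> B \in indep M.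
Proof. by rewrite inE => /maxsetp. Qed.

Lemma indep_base M I : I \in indep M -> exists2 B, B \in bases M & I \subset B.
Proof.
move=> /(@maxset_exists _ (fun I => I \in indep M)) [B maxB sIB].
by exists B; rewrite ?inE.
Qed.

Lemma base_card_max M B I : B \in bases M -> I \in indep M -> #|I| <= #|B|.
Proof.
move=> Bbase Iind; rewrite leqNgt; apply/negP => lt.
have [x /setDP [_ xB] xBind] := indep_aug (base_indep Bbase) Iind lt.
move: Bbase; rewrite inE => /maxsetP [_ /(_ _ xBind (subsetUr _ _)) eqB].
by move: xB; rewrite -eqB setU11.
Qed.

Lemma card_base M B B' : B \in bases M -> B' \in bases M -> #|B| = #|B'|.
Proof.
move=> BB BB'; apply/eqP; rewrite eqn_leq.
by rewrite (base_card_max BB (base_indep BB')) (base_card_max BB' (base_indep BB)).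
Qed.

Lemma indep_extend M I J : I \in indep M -> J \in indep M -> #|I| <= #|J| ->
  exists K, [/\ K \in indep M, I \subset K, K \subset I :|: J & #|K| = #|J|].
Proof.
move=> Iind Jind; move: {2}(_ - _) (erefl (#|J| - #|I|)) => k.
elim: k I Iind => [|k IHk] I Iind dk le.
  exists I; split=> //; first exact: subsetUl.
  by apply/eqP; rewrite eqn_leq le -subn_eq0 dk.
have lt : #|I| < #|J| by rewrite -subn_gt0 dk.
have [x /setDP [xJ xI] xIind] := indep_aug Iind Jind lt.
have cx : #|x |: I| = #|I|.+1 by rewrite cardsU1 xI.
have [||K [Kind sK Ks cK]] := IHk _ xIind; rewrite ?cx //.
  by rewrite subnS dk.
exists K; split=> //; first exact: subset_trans (subsetUr _ _) sK.
apply: subset_trans Ks _; rewrite -setUA subUset subxx andbT.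
by rewrite sub1set inE xJ orbT.
Qed.

Definition dual_indep M : {set {set T}} :=
  [set X : {set T} | (X \subset ground M) &&
                     [exists B in bases M, [disjoint X & B]]].

Lemma dual_indepP M X :
  reflect (X \subset ground M /\
           exists2 B, B \in bases M & [disjoint X & B])
          (X \in dual_indep M).
Proof.
rewrite inE; apply: (iffP andP) => -[sX].
  by move=> /existsP [B /andP [? ?]]; split=> //; exists B.
by move=> [B BB dB]; split=> //; apply/existsP; exists B; rewrite BB.
Qed.

Lemma dual_ground M I : I \in dual_indep M -> I \subset ground M.
Proof. by case/dual_indepP. Qed.

Lemma dual_indep0 M : set0 \in dual_indep M.
Proof.
apply/dual_indepP; split; first exact: sub0set.
by have [B BB _] := indep_base (indep0 M); exists B; rewrite // -setI_eq0 set0I.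
Qed.

Lemma dual_indepS M I J :
  I \subset J -> J \in dual_indep M -> I \in dual_indep M.
Proof.
move=> sIJ /dual_indepP [sJ [B BB dB]]; apply/dual_indepP; split.
  exact: subset_trans sIJ sJ.
by exists B => //; apply: disjointWl dB.
Qed.

Lemma dual_aug M I J : I \in dual_indep M -> J \in dual_indep M ->
  #|I| < #|J| -> exists2 x, x \in J :\: I & x |: I \in dual_indep M.
Proof.
move=> /dual_indepP [sI [BI BBI dI]] /dual_indepP [sJ [BJ BBJ dJ]] lt.
have BJI : BJ :\: I \in indep M by apply: indepS (subsetDl _ _) (base_indep BBJ).
have [|K [Kind sK Ks cK]] := indep_extend BJI (base_indep BBI).
  exact: (base_card_max BBI BJI).
have Kbase : K \in bases M.
  rewrite inE; apply/maxsetP; split=> // L Lind sKL.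
  by apply/esym/eqP; rewrite eqEcard sKL cK (base_card_max BBI Lind).
have dIK : [disjoint I & K].
  apply/pred0P => x /=; apply/negP => /andP [xI xK].
  move/subsetP/(_ _ xK): Ks; rewrite !inE xI /= => xBI.
  by move/pred0P/(_ x): dI; rewrite /= xI xBI.
have [sub|/subsetPn [x xJI xK]] := boolP (J :\: I \subset K); last first.
  exists x => //; apply/dual_indepP; split.
    rewrite subUset sub1set sI andbT; apply: (subsetP sJ).
    by case/setDP: xJI.
  exists K => //; apply/pred0P => y /=; rewrite !inE.
  apply/negP => /andP [/orP [/eqP ->|yI] yK]; first by rewrite yK in xK.
  by move/pred0P/(_ y): dIK; rewrite /= yI yK.
exfalso.
have sUK : (BJ :\: I) :|: (J :\: I) \subset K by rewrite subUset sK.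
have := subset_leq_card sUK; rewrite cK (card_base BBI BBJ).
have dBJ : BJ :&: J = set0 by apply/eqP; rewrite setI_eq0 disjoint_sym.
have -> : (BJ :\: I) :|: (J :\: I) = (BJ :|: J) :\: I by rewrite setDUl.
have cU : #|BJ :|: J| = #|BJ| + #|J| by rewrite cardsU dBJ cards0 subn0.
have := cardsID I (BJ :|: J); rewrite cU => eqc le.
have := subset_leq_card (subsetIr (BJ :|: J) I).
move=> le2; have : #|BJ| + #|J| <= #|I| + #|BJ| by rewrite -eqc leq_add.
by rewrite addnC leq_add2r leqNgt lt.
Qed.

Definition dual M : matroid T :=
  @Matroid T (ground M) (dual_indep M)
    (@dual_ground M) (@dual_indep0 M) (@dual_indepS M) (@dual_aug M).

Definition restr_indep M A : {set {set T}} :=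
  [set I in indep M | I \subset A].

Lemma restr_ground M A I : I \in restr_indep M A -> I \subset ground M :&: A.
Proof. by rewrite inE subsetI => /andP [/indep_ground -> ->]. Qed.

Lemma restr_indep0 M A : set0 \in restr_indep M A.
Proof. by rewrite inE indep0 sub0set. Qed.

Lemma restr_indepS M A I J :
  I \subset J -> J \in restr_indep M A -> I \in restr_indep M A.
Proof.
rewrite !inE => sIJ /andP [Jind sJ].
by rewrite (indepS sIJ Jind) (subset_trans sIJ sJ).
Qed.

Lemma restr_aug M A I J : I \in restr_indep M A -> J \in restr_indep M A ->
  #|I| < #|J| -> exists2 x, x \in J :\: I & x |: I \in restr_indep M A.
Proof.
rewrite !inE => /andP [Iind sI] /andP [Jind sJ] lt.
have [x xJI xI] := indep_aug Iind Jind lt; exists x => //.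
rewrite inE xI subUset sub1set sI andbT; apply: (subsetP sJ).
by case/setDP: xJI.
Qed.

Definition restriction M A : matroid T :=
  @Matroid T (ground M :&: A) (restr_indep M A) (@restr_ground M A)
    (@restr_indep0 M A) (@restr_indepS M A) (@restr_aug M A).

(* Contraction to (not of) A. *)
Definition contraction_to M A : matroid T := dual (restriction (dual M) A).

End MatroidOperations.

Section Families.

Variables (T : finType).
Implicit Types (I J X : {set T}).

(* Families are indexed, so the same matroid may occur at several indices. *)
Definition family_ground (K : finType) (H : K -> matroid T) : {set T} :=
  \bigcup_i ground (H i).

Definition union_indep (K : finType) (H : K -> matroid T) : {set {set T}} :=
  [set X | [exists f : {ffun K -> {set T}},
     [forall i, f i \in indep (H i)] && (X == \bigcup_i f i)]].

Section UnionMatroid.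

Variables (K : finType) (H : K -> matroid T).

Lemma union_indepP X :
  reflect (exists2 f : {ffun K -> {set T}},
             forall i, f i \in indep (H i) & X = \bigcup_i f i)
          (X \in union_indep H).
Proof.
rewrite inE; apply: (iffP existsP) => [[f /andP [/forallP fi /eqP ->]]|[f fi ->]].
  by exists f.
by exists f; rewrite eqxx andbT; apply/forallP.
Qed.

Lemma union_ground I : I \in union_indep H -> I \subset family_ground H.
Proof.
case/union_indepP => f fi ->; apply/bigcupsP => i _.
exact: subset_trans (indep_ground (fi i)) (bigcup_sup i _).
Qed.

Lemma union_indep0 : set0 \in union_indep H.
Proof.
apply/union_indepP; exists [ffun=> set0] => [i|]; first by rewrite ffunE indep0.
by rewrite big1 // => i _; rewrite ffunE.
Qed.

Lemma union_indepS I J :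
  I \subset J -> J \in union_indep H -> I \in union_indep H.
Proof.
move=> sIJ /union_indepP [f fi eqJ].
apply/union_indepP; exists [ffun i => I :&: f i] => [i|].
  by rewrite ffunE; apply: indepS (subsetIr _ _) (fi i).
rewrite (eq_bigr (fun i => I :&: f i)) => [|i _]; last by rewrite ffunE.
by rewrite -big_distrr /= -eqJ; apply/esym/setIidPl.
Qed.

(* A colouring encodes pairwise disjoint independent sets of the members. *)
Let cls (c : {ffun T -> option K}) i : {set T} := [set x | c x == Some i].
Let coloured (c : {ffun T -> option K}) : {set T} := [set x | c x].
Let good c := [forall i, cls c i \in indep (H i)].

Let union_colouringP X :
  reflect (exists2 c, good c & X = coloured c) (X \in union_indep H).
Proof.
apply: (iffP (union_indepP X)) => -[].
  move=> f fi ->; exists [ffun x => [pick i | x \in f i]].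
    apply/forallP => i; apply: indepS (fi i); apply/subsetP => x.
    by rewrite inE ffunE; case: pickP => // j xj /eqP [<-].
  apply/setP => x; rewrite inE ffunE; apply/bigcupP/idP.
    by move=> [i _ xi]; case: pickP => // /(_ i); rewrite xi.
  by case: pickP => // i xi _; exists i.
move=> c /forallP gc ->; exists [ffun i => cls c i] => [i|]; first by rewrite ffunE.
apply/setP => x; apply/idP/bigcupP; rewrite !inE.
  by case cx: (c x) => [i|] // _; exists i; rewrite // ffunE inE cx.
by move=> [i _]; rewrite ffunE inE => /eqP ->.
Qed.

Let card_coloured c : #|coloured c| = \sum_i #|cls c i|.
Proof.
have -> : coloured c = \bigcup_i cls c i.
  apply/setP => x; apply/idP/bigcupP; rewrite !inE.
    by case cx: (c x) => [i|] // _; exists i; rewrite // inE cx.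
  by move=> [i _]; rewrite inE => /eqP ->.
rewrite -sum1_card partition_disjoint_bigcup /=; last first.
  move=> i j nij; apply/pred0P => x /=; rewrite !inE.
  by apply/negP => /andP [/eqP -> /eqP [/eqP]]; rewrite (negPf nij).
by apply: eq_bigr => i _; rewrite sum1_card.
Qed.

Lemma union_aug I J : I \in union_indep H -> J \in union_indep H ->
  #|I| < #|J| -> exists2 x, x \in J :\: I & x |: I \in union_indep H.
Proof.
move=> /union_colouringP [c0 gc0 eqI] /union_colouringP [d gd eqJ] lt.
pose P c := good c && (coloured c == I).
pose ov (c : {ffun T -> option K}) := #|[set x | d x && (c x == d x)]|.
have Pc0 : P c0 by rewrite /P gc0 eqI eqxx.
case: (arg_maxnP ov Pc0) => c /andP [gc /eqP cI] maxc.
have [i lti] : exists i, #|cls c i| < #|cls d i|.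
  apply/existsP; apply: contraLR lt => /existsPn le.
  rewrite -leqNgt eqJ -cI !card_coloured; apply: leq_sum => i _.
  by rewrite leqNgt le.
have [t /setDP []] := indep_aug (forallP gc i) (forallP gd i) lti.
rewrite !inE => /eqP dt ct tind.
pose c' := [ffun x => if x == t then Some i else c x].
have gc' : good c'.
  apply/forallP => j; have [->|nji] := eqVneq j i.
    apply: indepS tind; apply/subsetP => x; rewrite !inE ffunE.
    by case: (x == t).
  apply: indepS (forallP gc j); apply/subsetP => x; rewrite !inE ffunE.
  by case: (x == t) => // /eqP [/eqP]; rewrite eq_sym (negPf nji).
have c'I : coloured c' = t |: I.
  by apply/setP => x; rewrite -cI !inE ffunE; case: (x == t).
have tJ : t \in J by rewrite eqJ inE dt.
have [tI|tI] := boolP (t \in I); last first.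
  by exists t; [rewrite inE tI | apply/union_colouringP; exists c'].
exfalso; have Pc' : P c'.
  by rewrite /P gc' c'I; apply/eqP/setUidPr; rewrite sub1set.
have := maxc c' Pc'; apply/negP; rewrite -ltnNge; apply: proper_card.
apply/properP; split.
  apply/subsetP => x; rewrite !inE ffunE => /andP [-> /eqP ->] /=.
  by have [->|_] := eqVneq x t; rewrite ?dt eqxx.
by exists t; rewrite !inE ?ffunE dt ?eqxx.
Qed.

Definition matroid_union : matroid T :=
  @Matroid T (family_ground H) (union_indep H)
    union_ground union_indep0 union_indepS union_aug.

End UnionMatroid.

Definition associative_family (K : finType) (H : K -> matroid T) : Prop :=
  forall e : T, #|[set i | e \in ground (H i)]| <= 2.

Definition once_covered (K : finType) (H : K -> matroid T) : {set T} :=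
  [set e | #|[set i | e \in ground (H i)]| == 1].

(* Usually written with a prefix double-headed arrow; it is the empty matroid
   when no element is covered exactly once. *)
Definition linkage (K : finType) (H : K -> matroid T) : matroid T :=
  contraction_to (matroid_union H) (once_covered H).

Definition subfamily (K : finType) (H : K -> matroid T) (A : {set K}) :
  {i : K | i \in A} -> matroid T := fun i => H (val i).

Definition pair_family (M1 M2 : matroid T) : bool -> matroid T :=
  fun b => if b then M1 else M2.

Definition rigid (K : finType) (H : K -> matroid T) : Prop :=
  rank (matroid_union H) = \sum_i rank (H i) /\
  rank (matroid_union (fun i => dual (H i))) = \sum_i rank (dual (H i)).

(* In the graph of a family the vertices are the indices and the edges are the
   elements of [family_ground H]; for i = j the edge is a self-loop. *)
Definition edge_joins (K : finType) (H : K -> matroid T) (e : T) (i j : K) :=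
  if i == j then [set k | e \in ground (H k)] == [set i]
  else e \in ground (H i) :&: ground (H j).

Definition family_graph_connected (K : finType) (H : K -> matroid T) : Prop :=
  forall i j : K, connect (fun k l => [exists e, edge_joins H e k l]) i j.

End Families.

Arguments subfamily {T K} H A.

(* Main.v *)
Require Import Defs.
From mathcomp Require Import all_boot.

(** Rigidity is a statement about choices of one base [F i] in each member
    [H i].  The rank of the union matroid attains the sum of the ranks exactly
    when the bases can be chosen pairwise disjoint (a [packing]).  The same
    equality for the dual matroids says that some choice of bases has pairwise
    disjoint complements, that is, covers every element shared by two members
    (a [covering]).  So a family is rigid iff it has a packing and a covering
    ([rigidP]); the two choices may differ.

    The point is that in a rigid associative family they can be made to agree.
    Let Z be the set of elements covered once and W the shared elements.  A
    covering shows that W is independent in the union matroid, so the union of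
    any packing P can be exchanged for a base containing W without gaining
    elements of Z.  By the rank equality this base is again a disjoint union of
    bases, now containing W: a choice which is both a packing and a covering,
    and whose trace on Z lies in the trace of P ([packing_tighten]).  Dually,
    any covering can be replaced by such a choice whose trace on Z contains
    the trace of the covering ([covering_tighten]).  Moreover, W being
    independent, the bases of the linkage (the union matroid contracted to Z)
    are precisely the traces on Z of the choices that are both a packing and a
    covering ([linkage_baseP]).

    Now split the family into subfamilies A and B.  An element shared by a
    member of A and a member of B is, by associativity, covered once within A
    and once within B, so the interaction between the two halves takes place
    only on the common elements of the two linkages.  If the whole family is
    rigid, a packing restricts to both halves; tightening the restrictions
    only shrinks their traces, hence yields disjoint bases of the linkages.
    Tightening the restrictions of a covering only enlarges the traces, hence
    yields bases of the linkages that cover their common elements.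
    Conversely, disjoint bases of the linkages are traces of packings of the
    halves, which glue to a packing of the family ([packing_glue]); bases
    covering the common elements come from coverings, which glue to a covering
    ([covering_glue]). *)

Set Implicit Arguments.
Unset Strict Implicit.
Unset Printing Implicit Defensive.

(** * Bases, duality and contraction *)

Section Bases.

Variables (T : finType).
Implicit Types (M : matroid T) (B I X Z : {set T}).

Lemma base_ground M B : B \in bases M -> B \subset ground M.
Proof. by move=> /base_indep/indep_ground. Qed.

Lemma card_base_rank M B : B \in bases M -> #|B| = rank M.
Proof.
move=> BB; apply/eqP; rewrite eqn_leq (leq_bigmax_cond _ (base_indep BB)) /=.
by apply/bigmax_leqP => I; apply: base_card_max.
Qed.

Lemma indep_card_rank M I : I \in indep M -> #|I| <= rank M.
Proof. exact: leq_bigmax_cond. Qed.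

Lemma indep_rank_base M I : I \in indep M -> rank M <= #|I| -> I \in bases M.
Proof.
move=> Iind le; rewrite inE; apply/maxsetP; split=> // J Jind sIJ.
by apply/esym/eqP; rewrite eqEcard sIJ (leq_trans _ le) ?indep_card_rank.
Qed.

Lemma base_exists M : exists B, B \in bases M.
Proof. by have [B BB _] := indep_base (indep0 M); exists B. Qed.

Lemma indep_extend_base M I B : I \in indep M -> B \in bases M ->
  exists2 B', B' \in bases M & I \subset B' /\ B' \subset I :|: B.
Proof.
move=> Iind BB; have le := base_card_max BB Iind.
have [B' [B'ind sI sB' cB']] := indep_extend Iind (base_indep BB) le.
exists B' => //; apply: indep_rank_base => //.
by rewrite cB' (card_base_rank BB).
Qed.

Lemma baseC_dual M B : B \in bases M -> ground M :\: B \in bases (dual M).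
Proof.
move=> BB; rewrite inE; apply/maxsetP; split.
  apply/dual_indepP; split; first exact: subsetDl.
  by exists B => //; rewrite -setI_eq0 setIDAC setDIl setDv setI0.
move=> J /dual_indepP [sJ [B' BB' dJ]] sBJ; apply/eqP.
rewrite eq_sym eqEcard sBJ /=.
have sJ' : J \subset ground M :\: B' by rewrite subsetD sJ.
apply: leq_trans (subset_leq_card sJ') _.
by rewrite !cardsDS ?base_ground // (card_base BB BB').
Qed.

Lemma dual_baseC M B : B \in bases (dual M) -> ground M :\: B \in bases M.
Proof.
move=> BB; have /dual_indepP [sB [B' BB' dB]] := base_indep BB.
have sBB' : B \subset ground M :\: B' by rewrite subsetD sB.
have eqB : B = ground M :\: B'.
  apply/eqP; rewrite eqEcard sBB' (card_base BB (baseC_dual BB')) //=.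
by rewrite eqB setDDr setDv set0U (setIidPr (base_ground BB')).
Qed.

(** When the contracted elements are independent, every base of the contraction
    extends by all of them to a base of [M]; in general only a maximal
    independent set of contracted elements could be added. *)
Lemma base_contraction_toP M Z D : Z \subset ground M ->
  ground M :\: Z \in indep M ->
  D \in bases (contraction_to M Z) <->
  exists2 B, B \in bases M & ground M :\: Z \subset B /\ D = Z :&: B.
Proof.
move=> sZ Wind; have gR : ground (restriction (dual M) Z) = Z.
  by rewrite /=; apply/setIidPr.
split=> [DB|[B BB [sWB ->]]].
  have sD : D \subset Z by have := base_ground DB; rewrite /= (setIidPr sZ).
  have := dual_baseC DB; rewrite gR => QB.
  have := base_indep QB; rewrite inE => /andP [/dual_indepP [_ [B BB dB]] _].
  (* Exchanging B for a base containing the contracted elements gains nothing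
     inside Z, so the new base still avoids Z :\: D. *)
  have [B' BB' [sWB' sB']] := indep_extend_base Wind BB.
  exists B' => //; split=> //.
  have ZB'ind : Z :\: B' \in indep (restriction (dual M) Z).
    rewrite inE subsetDl andbT; apply/dual_indepP; split.
      exact: subset_trans (subsetDl _ _) sZ.
    by exists B' => //; rewrite -setI_eq0 setIDAC setDIl setDv setI0.
  have eqQ : Z :\: B' = Z :\: D.
    move: QB; rewrite inE => /maxsetP [_ /(_ _ ZB'ind)]; apply.
    apply/subsetP => x /setDP [xZ xD]; rewrite inE xZ andbT.
    apply: contraNN xD => /(subsetP sB'); rewrite !inE xZ /= => xB.
    apply: contraTT xB => xD.
    by have /pred0P/(_ x) /= := dB; rewrite !inE xD xZ /= => ->.
  have := congr1 (fun X => Z :\: X) eqQ.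
  by rewrite !setDDr setDv !set0U (setIidPr sD).
have <- : Z :\: (ground M :\: B) = Z :&: B.
  by move: sZ; rewrite setDDr -setD_eq0 => /eqP ->; rewrite set0U.
(* The complement of B lies in Z, so its maximality among all coindependent
   sets gives maximality among those inside Z. *)
rewrite -{1}gR; apply: baseC_dual.
have QB := baseC_dual BB; have := QB; rewrite inE => /maxsetP [Qind Qmax].
rewrite inE; apply/maxsetP; split.
  rewrite inE Qind; apply/subsetP => x /setDP [xg xB].
  by apply: contraNT xB => xZ; apply: (subsetP sWB); rewrite inE xZ.
by move=> J; rewrite inE => /andP [Jind _]; apply: Qmax.
Qed.

End Bases.

(** * Packings and coverings by bases *)

Section Selections.

Variables (T : finType).

Definition packing (K : finType) (H : K -> matroid T) (F : K -> {set T}) :=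
  (forall i, F i \in bases (H i)) /\
  (forall i j e, e \in F i -> e \in F j -> i = j).

(** Equivalently, the complements of the [F i] in their ground sets are pairwise
    disjoint; stated on [F] itself so that one choice of bases can be asked to
    be both a packing and a covering. *)
Definition covering (K : finType) (H : K -> matroid T) (F : K -> {set T}) :=
  (forall i, F i \in bases (H i)) /\
  (forall i j e, i != j -> e \in ground (H i) -> e \in ground (H j) ->
     e \in F i \/ e \in F j).

Variables (K : finType) (H : K -> matroid T).
Implicit Types (F P C : K -> {set T}) (U D : {set T}).

Lemma card_bigcup_leq F : #|\bigcup_i F i| <= \sum_i #|F i|.
Proof.
elim/big_rec2: _ => [|i m X _ le]; first by rewrite cards0.
by apply: leq_trans (leq_card_setU _ _) _; rewrite leq_add2l.
Qed.

Lemma card_bigcup_disjoint F : (forall i j e, e \in F i -> e \in F j -> i = j) ->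
  #|\bigcup_i F i| = \sum_i #|F i|.
Proof.
move=> dF; rewrite -sum1_card partition_disjoint_bigcup /=.
  by apply: eq_bigr => i _; rewrite sum1_card.
move=> i j nij; apply/pred0P => x /=; apply/negP => /andP [xi xj].
by rewrite (dF _ _ _ xi xj) eqxx in nij.
Qed.

(** Were [e] in two of the sets, deleting it from one of them would leave the
    union unchanged but lower the sum of the cardinals. *)
Lemma bigcup_card_disjoint F : \sum_i #|F i| <= #|\bigcup_i F i| ->
  forall i j e, e \in F i -> e \in F j -> i = j.
Proof.
move=> le i j e ei ej; apply/eqP; apply: contraLR le => nij; rewrite -ltnNge.
pose F' k := if k == i then F i :\ e else F k.
have -> : \bigcup_k F k = \bigcup_k F' k.
  apply/setP => x; apply/bigcupP/bigcupP => -[k _ xk]; last first.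
    exists k => //; move: xk; rewrite /F'; case: eqP => // -> .
    by case/setD1P.
  have [->|nx] := eqVneq x e.
    by exists j => //; rewrite /F' eq_sym (negPf nij).
  by exists k => //; rewrite /F'; case: eqP xk => // ->; rewrite !inE nx.
apply: leq_ltn_trans (card_bigcup_leq _) _.
rewrite (bigD1 i) // [X in _ < X](bigD1 i) //= /F' eqxx -addSn leq_add //.
  by rewrite (cardsD1 e (F i)) ei.
by apply: leq_sum => k /negPf ->.
Qed.

Lemma rank_union_leq : rank (matroid_union H) <= \sum_i rank (H i).
Proof.
apply/bigmax_leqP => X /union_indepP [f fi ->].
apply: leq_trans (card_bigcup_leq _) _; apply: leq_sum => i _.
exact: indep_card_rank.
Qed.

Lemma bigcup_union_indep F : (forall i, F i \in indep (H i)) ->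
  \bigcup_i F i \in indep (matroid_union H).
Proof.
move=> Find; apply/union_indepP; exists (finfun F) => [i|].
  by rewrite ffunE.
by apply: eq_bigr => i _; rewrite ffunE.
Qed.

Lemma card_packing P : packing H P -> #|\bigcup_i P i| = \sum_i rank (H i).
Proof.
move=> [PB dP]; rewrite card_bigcup_disjoint //.
by apply: eq_bigr => i _; apply: card_base_rank.
Qed.

Lemma packing_base P : packing H P ->
  \bigcup_i P i \in bases (matroid_union H).
Proof.
move=> pP; apply: indep_rank_base.
  by apply: bigcup_union_indep => i; apply: base_indep; case: pP => ->.
by rewrite (card_packing pP) rank_union_leq.
Qed.

(** Under the rank equality a base of the union matroid has as many elements as
    the ranks allow in total, so each of its independent pieces has full rank
    and no two pieces meet. *)
Lemma base_packing U : rank (matroid_union H) = \sum_i rank (H i) ->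
  U \in bases (matroid_union H) -> exists2 P, packing H P & U = \bigcup_i P i.
Proof.
move=> eqr UB; have /union_indepP [f find eqU] := base_indep UB.
have lef i : #|f i| <= rank (H i) by apply: indep_card_rank.
have cU : #|\bigcup_i f i| = \sum_i rank (H i).
  by rewrite -eqU -eqr; apply: card_base_rank.
have lesum : \sum_i rank (H i) <= \sum_i #|f i|.
  by rewrite -cU card_bigcup_leq.
exists f => //; split; last first.
  by apply: bigcup_card_disjoint; rewrite cU leq_sum.
move=> i; apply: indep_rank_base => //; rewrite leqNgt.
apply: contraL lesum => lt; rewrite -ltnNge.
rewrite (bigD1 i) // [X in _ < X](bigD1 i) //= -addSn leq_add //.
exact: leq_sum.
Qed.

Lemma rank_unionP :
  rank (matroid_union H) = \sum_i rank (H i) <-> exists P, packing H P.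
Proof.
split=> [eqr|[P pP]].
  have [U UB] := base_exists (matroid_union H).
  by have [P pP _] := base_packing eqr UB; exists P.
by rewrite -(card_base_rank (packing_base pP)) (card_packing pP).
Qed.

Definition selectionC F i := ground (H i) :\: F i.

Lemma disjoint_selectionC F : (forall i j e, e \in F i -> e \in F j -> i = j) ->
  forall i j e, i != j -> e \in ground (H i) -> e \in ground (H j) ->
    e \in selectionC F i \/ e \in selectionC F j.
Proof.
move=> dF i j e nij ei ej.
rewrite !inE ei ej !andbT; apply/orP; rewrite -negb_and.
by apply: contraNN nij => /andP [/dF/[apply]->].
Qed.

Lemma cover_selectionC F :
  (forall i j e, i != j -> e \in ground (H i) -> e \in ground (H j) ->
     e \in F i \/ e \in F j) ->
  forall i j e, e \in selectionC F i -> e \in selectionC F j -> i = j.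
Proof.
move=> cF i j e; rewrite !inE => /andP [nei ei] /andP [nej ej].
apply/eqP/idPn => nij.
by have [] := cF _ _ _ nij ei ej; apply/negP.
Qed.

Lemma packing_dualC P : packing (fun i => dual (H i)) P ->
  covering H (selectionC P).
Proof.
by move=> [PB dP]; split=> [i|]; [apply: dual_baseC | apply: disjoint_selectionC].
Qed.

Lemma covering_dualC C : covering (fun i => dual (H i)) C ->
  packing H (selectionC C).
Proof.
by move=> [CB cC]; split=> [i|]; [apply: dual_baseC | apply: cover_selectionC].
Qed.

Lemma packingC P : packing H P -> covering (fun i => dual (H i)) (selectionC P).
Proof.
by move=> [PB dP]; split=> [i|]; [apply: baseC_dual | apply: disjoint_selectionC].
Qed.

Lemma coveringC C : covering H C -> packing (fun i => dual (H i)) (selectionC C).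
Proof.
by move=> [CB cC]; split=> [i|]; [apply: baseC_dual | apply: cover_selectionC].
Qed.

End Selections.

(** * Rigid families and the bases of their linkage *)

Section Rigid.

Variables (T : finType).

(** The second rank equality asks for disjoint bases of the duals; complementing
    them turns this into a covering by bases of the members themselves. *)
Lemma rigidP (K : finType) (H : K -> matroid T) :
  rigid H <-> (exists P, packing H P) /\ (exists C, covering H C).
Proof.
split=> [[/rank_unionP hP /rank_unionP [C cC]]|[hP [C cC]]].
  by split=> //; exists (selectionC H C); apply: packing_dualC.
split; apply/rank_unionP => //.
by exists (selectionC H C); apply: coveringC.
Qed.

Lemma once_coveredP (K : finType) (H : K -> matroid T) e :
  reflect (exists2 i, e \in ground (H i) &
             forall j, e \in ground (H j) -> j = i)
          (e \in once_covered H).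
Proof.
rewrite inE; apply: (iffP cards1P) => [[i eqi]|[i ei ui]]; exists i.
- by move/setP/(_ i): eqi; rewrite !inE eqxx.
- by move=> j ej; move/setP/(_ j): eqi; rewrite !inE ej => /esym/eqP.
by apply/setP => j; rewrite !inE; apply/idP/eqP => [/ui|->].
Qed.

Lemma associative_third (K : finType) (H : K -> matroid T) e i j k :
  associative_family H -> i != j -> e \in ground (H i) ->
  e \in ground (H j) -> e \in ground (H k) -> k = i \/ k = j.
Proof.
move=> /(_ e) le2 nij ei ej ek.
have s2 : [set i; j] \subset [set l | e \in ground (H l)].
  by apply/subsetP => l /set2P [] ->; rewrite inE.
have eq2 : [set i; j] = [set l | e \in ground (H l)].
  by apply/eqP; rewrite eqEcard s2 cards2 nij.
by apply/set2P; rewrite eq2 inE.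
Qed.

Section Linkage.

Variables (K : finType) (H : K -> matroid T).
Hypotheses (assocH : associative_family H) (rigidH : rigid H).

Let W := family_ground H :\: once_covered H.

Lemma once_covered_ground : once_covered H \subset family_ground H.
Proof.
apply/subsetP => e /once_coveredP [i ei _].
by apply/bigcupP; exists i.
Qed.

Lemma shared_pair e : e \in W ->
  exists i j, [/\ i != j, e \in ground (H i) & e \in ground (H j)].
Proof.
case/setDP => /bigcupP [i _ ei] ne.
have [/existsP [j /andP [ej nij]]|/existsPn none] :=
  boolP [exists j, (e \in ground (H j)) && (i != j)]; first by exists i, j.
case/negP: ne; apply/once_coveredP; exists i => // j ej.
by move: (none j); rewrite ej /= negbK => /eqP.
Qed.

Lemma covering_shared C : covering H C -> W \subset \bigcup_i C i.
Proof.
move=> [_ cC]; apply/subsetP => e /shared_pair [i [j [nij ei ej]]].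
by apply/bigcupP; case: (cC _ _ _ nij ei ej); [exists i | exists j].
Qed.

Lemma shared_indep : W \in indep (matroid_union H).
Proof.
have [_ [C cC]] := (rigidP H).1 rigidH.
apply: indepS (covering_shared cC) _; apply: bigcup_union_indep => i.
by apply: base_indep; case: cC => ->.
Qed.

(** This is where associativity enters: the member whose base contains a shared
    element can only be one of the two members sharing it. *)
Lemma packing_shared P : packing H P -> W \subset \bigcup_i P i -> covering H P.
Proof.
move=> [PB dP] sW; split=> // i j e nij ei ej.
have eW : e \in W.
  rewrite inE; apply/andP; split; last by apply/bigcupP; exists i.
  apply/negP => /once_coveredP [k _ uk].
  by rewrite (uk _ ei) (uk _ ej) eqxx in nij.
have /bigcupP [k _ ek] := subsetP sW _ eW.
have gk := subsetP (base_ground (PB k)) _ ek.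
by have [<-|<-] := associative_third assocH nij ei ej gk; [left|right].
Qed.

(** For a packing, being also a covering amounts to containing the shared
    elements [W], and these are the bases of the union matroid from which
    contraction to the elements covered once produces its bases. *)
Lemma linkage_baseP D :
  D \in bases (linkage H) <->
  exists2 F, packing H F /\ covering H F &
    D = once_covered H :&: \bigcup_i F i.
Proof.
apply: iff_trans (base_contraction_toP (M := matroid_union H) D
  once_covered_ground shared_indep) _.
split=> [[U UB [sW ->]]|[F [pF cF] ->]].
  have [P pP eqU] := base_packing rigidH.1 UB.
  exists P; rewrite -?eqU //; split=> //.
  by apply: packing_shared => //; rewrite -eqU.
exists (\bigcup_i F i); first exact: packing_base.
by split=> //; apply: covering_shared.
Qed.

(** Exchange in the union matroid: the base given by [P] is replaced by one
    containing the shared elements [W] and otherwise contained in it. *)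
Lemma packing_tighten P : packing H P ->
  exists2 F, packing H F /\ covering H F &
    once_covered H :&: \bigcup_i F i \subset \bigcup_i P i.
Proof.
move=> pP.
have [U UB [sW sU]] := indep_extend_base shared_indep (packing_base pP).
have [F pF eqU] := base_packing rigidH.1 UB.
exists F; rewrite -?eqU.
  by split=> //; apply: packing_shared => //; rewrite -eqU.
apply/subsetP => e /setIP [eZ /(subsetP sU)].
by rewrite in_setU inE eZ.
Qed.

End Linkage.

(** The dual of [packing_tighten].  Complementation reverses the inclusion of
    traces because an element covered once lies in a single ground set, so
    it belongs to the union of a choice of bases exactly when it is missing
    from the union of the complements. *)
Lemma covering_tighten (K : finType) (H : K -> matroid T) C :
  associative_family H -> rigid H -> covering H C ->
  exists2 F, packing H F /\ covering H F &
    once_covered H :&: \bigcup_i C i \subset \bigcup_i F i.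
Proof.
move=> aH /rigidP [[P pP] _] cC.
have rH' : rigid (fun i => dual (H i)).
  apply/rigidP; split; first by exists (selectionC H C); apply: coveringC.
  by exists (selectionC H P); apply: packingC.
have [F [pF cF] sF] := packing_tighten (H := fun i => dual (H i)) aH rH' (coveringC cC).
exists (selectionC H F).
  by split; [apply: covering_dualC | apply: packing_dualC].
apply/subsetP => e /setIP [eZ /bigcupP [i _ eC]].
have ei := subsetP (base_ground (cC.1 i)) _ eC.
apply/bigcupP; exists i => //; rewrite inE ei andbT; apply/negP => eF.
have /(subsetP sF)/bigcupP [j _] : e \in once_covered H :&: \bigcup_i F i.
  by rewrite inE eZ; apply/bigcupP; exists i.
rewrite inE => /andP [neC ej]; case/once_coveredP: eZ => k _ uk.
by rewrite (uk _ ej) -(uk _ ei) eC in neC.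
Qed.

Lemma associative_subfamily (K : finType) (H : K -> matroid T) (A : {set K}) :
  associative_family H -> associative_family (subfamily H A).
Proof.
move=> aH e; apply: leq_trans (aH e); rewrite -(card_imset _ val_inj).
by apply: subset_leq_card; apply/subsetP => _ /imsetP [u + ->]; rewrite !inE.
Qed.

End Rigid.

(** * Splitting a family into two subfamilies *)

Section Glue.

Variables (T : finType) (K : finType) (H : K -> matroid T) (A B : {set K}).
Hypotheses (coverAB : A :|: B = [set: K]) (disjAB : [disjoint A & B]).

Lemma mem_or i : i \in A \/ i \in B.
Proof. by apply/setUP; rewrite coverAB inE. Qed.

Lemma mem_neq i j : i \in A -> j \in B -> i != j.
Proof.
move=> iA jB; apply: contraTneq iA => ->.
by apply/negP => jA; move/pred0P/(_ j): disjAB; rewrite /= jA jB.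
Qed.

Lemma glue (FA : {i : K | i \in A} -> {set T}) (FB : {i : K | i \in B} -> {set T}) :
  exists F : K -> {set T},
    (forall u, F (val u) = FA u) /\ (forall v, F (val v) = FB v).
Proof.
exists (fun i => if insub i is Some u then FA u else
                 if insub i is Some v then FB v else set0).
split=> [u|v]; first by rewrite valK.
rewrite insubN ?valK //; apply/negP => vA.
by have := mem_neq vA (valP v); rewrite eqxx.
Qed.

(** The two members sharing [e] lie in different halves, so by associativity
    neither half contains a second member through [e]. *)
Lemma once_covered_meet i j e : associative_family H ->
  i \in A -> j \in B -> e \in ground (H i) -> e \in ground (H j) ->
  e \in once_covered (subfamily H A) /\ e \in once_covered (subfamily H B).
Proof.
move=> aH iA jB ei ej; have nij := mem_neq iA jB.
split; apply/once_coveredP.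
  exists (Sub i iA) => // u eu; apply: val_inj => /=.
  case: (associative_third aH nij ei ej eu) => // eqj.
  by have := mem_neq (valP u) jB; rewrite eqj eqxx.
exists (Sub j jB) => // u eu; apply: val_inj => /=.
case: (associative_third aH nij ei ej eu) => // eqi.
by have := mem_neq iA (valP u); rewrite eqi eqxx.
Qed.

Hypothesis assocH : associative_family H.

Let ZA := once_covered (subfamily H A).
Let ZB := once_covered (subfamily H B).

(** Disjointness on the elements covered once suffices, since every element
    common to a member in [A] and a member in [B] is of that kind. *)
Lemma packing_glue FA FB :
  packing (subfamily H A) FA -> packing (subfamily H B) FB ->
  [disjoint ZA :&: \bigcup_u FA u & ZB :&: \bigcup_v FB v] ->
  exists P, packing H P.
Proof.
move=> [bA dA] [bB dB] dAB; have [P [PA PB]] := glue FA FB; exists P.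
have baseP i : P i \in bases (H i).
  have [iX|iX] := mem_or i.
    by have := bA (Sub i iX); rewrite -PA.
  by have := bB (Sub i iX); rewrite -PB.
have cross i j e : i \in A -> j \in B -> e \in P i -> e \in P j -> False.
  move=> iA jB ei ej.
  have gi := subsetP (base_ground (baseP i)) _ ei.
  have gj := subsetP (base_ground (baseP j)) _ ej.
  have [eA eB] := once_covered_meet assocH iA jB gi gj.
  have /pred0P/(_ e)/negP := dAB; apply; rewrite /= !in_setI eA eB /=.
  apply/andP; split; apply/bigcupP.
    by exists (Sub i iA); rewrite // -PA.
  by exists (Sub j jB); rewrite // -PB.
split=> // i j e ei ej.
have [iX|iX] := mem_or i; have [jX|jX] := mem_or j.
- by apply: (congr1 val (dA (Sub i iX) (Sub j jX) e _ _)); rewrite -PA.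
- by case: (cross i j e).
- by case: (cross j i e).
by apply: (congr1 val (dB (Sub i iX) (Sub j jX) e _ _)); rewrite -PB.
Qed.

(** As for packings, only elements covered once can be shared across the
    partition.  If the base of some member contains such an element, that
    member is one of the two sharing it. *)
Lemma covering_glue FA FB :
  covering (subfamily H A) FA -> covering (subfamily H B) FB ->
  ZA :&: ZB \subset \bigcup_u FA u :|: \bigcup_v FB v ->
  exists C, covering H C.
Proof.
move=> [bA cA] [bB cB] cAB; have [C [CA CB]] := glue FA FB; exists C.
have baseC i : C i \in bases (H i).
  have [iX|iX] := mem_or i.
    by have := bA (Sub i iX); rewrite -CA.
  by have := bB (Sub i iX); rewrite -CB.
have cross i j e : i \in A -> j \in B -> e \in ground (H i) ->
    e \in ground (H j) -> e \in C i \/ e \in C j.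
  move=> iA jB ei ej; have nij := mem_neq iA jB.
  have [eA eB] := once_covered_meet assocH iA jB ei ej.
  have third k : e \in C k -> k = i \/ k = j.
    move=> ek; apply: (associative_third assocH nij ei ej).
    exact: subsetP (base_ground (baseC k)) _ ek.
  have /(subsetP cAB)/setUP : e \in ZA :&: ZB by rewrite inE eA eB.
  case=> /bigcupP [u _]; rewrite -?CA -?CB => eu.
    by have [<-|<-] := third _ eu; [left|right].
  by have [<-|<-] := third _ eu; [left|right].
split=> // i j e nij ei ej.
have [iX|iX] := mem_or i; have [jX|jX] := mem_or j.
- by have := cA (Sub i iX) (Sub j jX) e; rewrite -!CA; apply.
- exact: cross.
- by have [] := cross j i e jX iX ej ei; [right|left].
by have := cB (Sub i iX) (Sub j jX) e; rewrite -!CB; apply.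
Qed.

Lemma packing_subfamily X P : packing H P ->
  packing (subfamily H X) (fun u => P (val u)).
Proof.
move=> [PB dP]; split=> [u|u v e eu ev]; first exact: PB.
exact/val_inj/(dP _ _ _ eu ev).
Qed.

Lemma covering_subfamily X C : covering H C ->
  covering (subfamily H X) (fun u => C (val u)).
Proof.
move=> [CB cC]; split=> [u|u v e nuv eu ev]; first exact: CB.
exact: cC.
Qed.

Lemma rigid_subfamily X : rigid H -> rigid (subfamily H X).
Proof.
move=> /rigidP [[P pP] [C cC]]; apply/rigidP; split.
  by eexists; apply: packing_subfamily pP.
by eexists; apply: covering_subfamily cC.
Qed.

Lemma packing_split P : packing H P ->
  [disjoint \bigcup_(u : {i | i \in A}) P (val u)
          & \bigcup_(v : {i | i \in B}) P (val v)].
Proof.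
move=> [_ dP]; apply/pred0P => e /=; apply/negP.
move=> /andP [/bigcupP [u _ eu] /bigcupP [v _ ev]].
by case/eqP: (mem_neq (valP u) (valP v)); apply: dP eu ev.
Qed.

Lemma covering_split C : covering H C ->
  ZA :&: ZB \subset \bigcup_(u : {i | i \in A}) C (val u)
               :|: \bigcup_(v : {i | i \in B}) C (val v).
Proof.
move=> [_ cC]; apply/subsetP => e /setIP [].
move=> /once_coveredP [u eu _] /once_coveredP [v ev _]; apply/setUP.
have [eC|eC] := cC _ _ _ (mem_neq (valP u) (valP v)) eu ev.
  by left; apply/bigcupP; exists u.
by right; apply/bigcupP; exists v.
Qed.

End Glue.

(** * Families of two matroids and the partition theorem *)

Section Pair.

Variables (T : finType) (M1 M2 : matroid T).
Implicit Types D : {set T}.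

Lemma packing_pair :
  (exists P, packing (pair_family M1 M2) P) <->
  exists D1 D2, [/\ D1 \in bases M1, D2 \in bases M2 & [disjoint D1 & D2]].
Proof.
split=> [[P [PB dP]]|[D1 [D2 [B1 B2 dD]]]].
  exists (P true), (P false); split; [exact: (PB true)|exact: (PB false)|].
  by apply/pred0P => e /=; apply/negP => /andP [/dP/[apply]].
exists (fun b : bool => if b then D1 else D2); split=> [[]|] //.
have notboth e : e \in D1 -> e \in D2 -> False.
  by move=> e1 e2; have /pred0P/(_ e) /= := dD; rewrite e1 e2.
by move=> [] [] e e1 e2 //; case: (notboth e).
Qed.

Lemma covering_pair :
  (exists C, covering (pair_family M1 M2) C) <->
  exists D1 D2, [/\ D1 \in bases M1, D2 \in bases M2 &
                    ground M1 :&: ground M2 \subset D1 :|: D2].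
Proof.
split=> [[C [CB cC]]|[D1 [D2 [B1 B2 /subsetP cD]]]].
  exists (C true), (C false); split; [exact: (CB true)|exact: (CB false)|].
  by apply/subsetP => e /setIP [e1 e2]; apply/setUP; exact: (cC true false).
exists (fun b : bool => if b then D1 else D2); split=> [[]|] //.
have cover e : e \in ground M1 -> e \in ground M2 -> e \in D1 \/ e \in D2.
  by move=> e1 e2; apply/setUP/cD; rewrite inE e1 e2.
move=> [] [] e // _ e1 e2; first exact: cover.
by have [] := cover e e2 e1; [right|left].
Qed.

End Pair.

Lemma ground_linkage (T K : finType) (H : K -> matroid T) :
  ground (linkage H) = once_covered H.
Proof. by apply/setIidPr; apply: once_covered_ground. Qed.

Theorem theorem65 (T : finType) (n : nat) (H : 'I_n -> matroid T)
    (A B : {set 'I_n}) :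
  associative_family H ->
  family_graph_connected H ->
  family_ground H != set0 ->
  A != set0 -> B != set0 -> A :|: B = [set: 'I_n] -> [disjoint A & B] ->
  (rigid H <->
   [/\ rigid (subfamily H A), rigid (subfamily H B) &
       rigid (pair_family (linkage (subfamily H A))
                          (linkage (subfamily H B)))]).
Proof.
move=> aH _ _ _ _ coverAB disjAB.
have aA := associative_subfamily A aH; have aB := associative_subfamily B aH.
split=> [rH|[rA rB /rigidP [/packing_pair pD /covering_pair cD]]].
  have rA := rigid_subfamily A rH; have rB := rigid_subfamily B rH.
  have [[P pP] [C cC]] := (rigidP H).1 rH.
  split=> //; apply/rigidP; split.
    have [FA fA sA] := packing_tighten aA rA (packing_subfamily A pP).
    have [FB fB sB] := packing_tighten aB rB (packing_subfamily B pP).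
    apply/packing_pair; eexists; eexists; split.
    - by apply/linkage_baseP => //; exists FA.
    - by apply/linkage_baseP => //; exists FB.
    exact: disjointW sA sB (packing_split disjAB pP).
  have [FA fA sA] := covering_tighten aA rA (covering_subfamily A cC).
  have [FB fB sB] := covering_tighten aB rB (covering_subfamily B cC).
  apply/covering_pair; eexists; eexists; split.
  - by apply/linkage_baseP => //; exists FA.
  - by apply/linkage_baseP => //; exists FB.
  rewrite !ground_linkage; apply/subsetP => e eZ; have /setIP [eA eB] := eZ.
  have /setUP [eC|eC] := subsetP (covering_split disjAB cC) _ eZ; apply/setUP.
    by left; rewrite inE eA (subsetP sA) // inE eA.
  by right; rewrite inE eB (subsetP sB) // inE eB.
apply/rigidP; split.
  have [DA [DB [/linkage_baseP [//|//|FA [pA _] ->]]]] := pD.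
  move=> /linkage_baseP [//|//|FB [pB _] ->].
  exact: (packing_glue coverAB disjAB aH pA pB).
have [DA [DB [/linkage_baseP [//|//|FA [_ cA] ->]]]] := cD.
move=> /linkage_baseP [//|//|FB [_ cB] ->]; rewrite !ground_linkage => sD.
apply: (covering_glue coverAB disjAB aH cA cB).
apply: subset_trans sD _.
exact: setUSS (subsetIr _ _) (subsetIr _ _).
Qed.
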